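(* Let $c=(c_1,\dots,c_k)$ be a composition and let $\beta_i=c_1+\cdots+c_i$ for $i=0,\dots,k$. Fix $q$ and let $h(x)=a_0+a_1x+\cdots+a_kx^k$ be the polynomial of smallest degree passing through the $k+1$ points $(\beta_i,q^{\beta_i})$, $i=0,\dots,k$ (the coefficients $a_i$ being functions of $q$). Then $a_k=(-1)^k g_c(q)$.
   Context: For a composition $c=(c_1,\dots,c_k)$ (positive integers), the composition polynomial is \[ g_c(q) := \int_{q}^{1} \int_{q}^{t_k} \cdots \int_{q}^{t_2} t_1^{c_1-1}\cdots t_k^{c_k-1}\, dt_1\cdots dt_k . \] *)

(* Defs.v *)
From Stdlib Require Import Rdefinitions.
From Coquelicot Require Import Coquelicot.
From mathcomp Require Import all_boot all_order all_algebra.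
From mathcomp Require Import Rstruct.

Set Implicit Arguments.
Unset Strict Implicit.
Unset Printing Implicit Defensive.

Import Order.TTheory GRing.Theory Num.Theory.
Local Open Scope ring_scope.

Definition is_composition (c : seq nat) : bool := all (fun m => 0 < m)%N c.

(* The exponents are consumed from the outermost variable inwards, so r lists
   c_i, ..., c_1; u is the upper bound of the t_i-integral and w is the part
   t_(i+1)^(c_(i+1)-1) ... t_k^(c_k-1) of the integrand already collected.
   RInt is oriented, so q > 1 is allowed. *)
Fixpoint iterated_RInt (q : R) (r : seq nat) (u w : R) : R :=
  if r is m :: r' then
    RInt (fun t : R => iterated_RInt q r' t (t ^+ m.-1 * w)%R) q u
  else w.

Definition composition_polynomial (c : seq nat) (q : R) : R :=
  iterated_RInt q (rev c) 1%R 1%R.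

Definition partial_sum (c : seq nat) (i : nat) : nat := sumn (take i c).

Definition interpolates (c : seq nat) (q : R) (p : {poly R}) : Prop :=
  forall i : nat, (i <= size c)%N ->
    p.[(partial_sum c i)%:R] = q ^+ partial_sum c i.

(* Degrees are compared through size, which is degree + 1 (0 for p = 0). *)
Definition min_interpolant (c : seq nat) (q : R) (h : {poly R}) : Prop :=
  interpolates c q h /\
  forall p : {poly R}, interpolates c q p -> (size h <= size p)%N.

(* Main.v *)
Require Import Defs.
From Stdlib Require Import Rdefinitions.
From Coquelicot Require Import Coquelicot.
From mathcomp Require Import all_boot all_order all_algebra.
From mathcomp Require Import Rstruct ring.

Import Order.TTheory GRing.Theory Num.Theory.
Local Open Scope ring_scope.

(** The coefficient of [X^k] in a polynomial of degree at most [k] is the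
    divided difference of its values at any [k + 1] distinct nodes.  So it is
    enough to show that the inner integral over [t_1, ..., t_i], as a function of
    its upper bound [u], is [(-1)^i] times the divided difference at
    [beta_0, ..., beta_i] of [b |-> q^b u^(beta_i - b)].  This goes by induction
    on [i]: the derivative in [u] is the previous integrand because the weight of
    [b] at level [i] is the one at level [i - 1] divided by [b - beta_i], and at
    [u = q] the divided difference is that of a constant, hence vanishes. *)

(** Nodes are identified by value, not by position, so this gives the classical divided difference
    only for duplicate-free lists. *)
Definition divdiff_weight {F : fieldType} (s : seq nat) (i : nat) : F :=
  \prod_(j <- s | j != i) (i%:R - j%:R)^-1.

Definition divdiff {F : fieldType} (s : seq nat) (f : nat -> F) : F :=
  \sum_(i <- s) f i * divdiff_weight s i.

Section DividedDifference.
Variable F : numFieldType.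
Implicit Types (s : seq nat) (f : nat -> F) (p r : {poly F}).

Definition node_poly s (i : nat) : {poly F} :=
  \prod_(j <- s | j != i) ('X - (j%:R)%:P).

Definition lagrange_poly s f : {poly F} :=
  \sum_(i <- s) (f i * divdiff_weight s i) *: node_poly s i.

Lemma node_polyE s i :
  node_poly s i = \prod_(j <- [seq k <- s | k != i]) ('X - (j%:R)%:P).
Proof. by rewrite /node_poly big_filter. Qed.

Lemma node_poly_monic s i : node_poly s i \is monic.
Proof. by apply: monic_prod => j _; exact: monicXsubC. Qed.

Lemma size_node_poly s i : uniq s -> i \in s -> size (node_poly s i) = size s.
Proof.
move=> us si; rewrite node_polyE size_prod_XsubC -rem_filter // size_rem //.
by case: s si {us}.
Qed.

Lemma node_poly_eq0 s i k : k \in s -> k != i -> (node_poly s i).[k%:R] = 0.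
Proof.
move=> sk ki; rewrite /node_poly horner_prod (big_rem k) //= ki.
by rewrite hornerXsubC subrr mul0r.
Qed.

Lemma node_poly_weight s i : divdiff_weight s i * (node_poly s i).[i%:R] = 1.
Proof.
rewrite /node_poly /divdiff_weight horner_prod -big_split /=.
apply: big1 => j ji; rewrite hornerXsubC mulVf // subr_eq0 eqr_nat eq_sym //.
Qed.

Lemma horner_lagrange_poly s f k : uniq s -> k \in s ->
  (lagrange_poly s f).[k%:R] = f k.
Proof.
move=> us sk; rewrite /lagrange_poly horner_sum (bigD1_seq k) //=.
rewrite hornerZ -mulrA node_poly_weight mulr1 big1 ?addr0 // => i ik.
by rewrite hornerZ node_poly_eq0 ?mulr0 // eq_sym.
Qed.

Lemma size_lagrange_poly s f : uniq s -> (size (lagrange_poly s f) <= size s)%N.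
Proof.
move=> us; rewrite /lagrange_poly big_seq.
apply: (big_ind (fun p : {poly F} => size p <= size s)%N).
- by rewrite size_poly0.
- by move=> p r hp hr; rewrite (leq_trans (size_polyD _ _)) // geq_max hp.
- by move=> i si; rewrite (leq_trans (size_scale_leq _ _)) // size_node_poly.
Qed.

Lemma coef_lagrange_poly s f : uniq s ->
  (lagrange_poly s f)`_(size s).-1 = divdiff s f.
Proof.
move=> us; rewrite /lagrange_poly coef_sum /divdiff !big_seq.
apply: eq_bigr => i si; rewrite coefZ -(size_node_poly _ _ us si) -lead_coefE.
by rewrite (monicP (node_poly_monic _ _)) mulr1.
Qed.

(** The difference would have more distinct roots than its degree allows; characteristic zero keeps
    distinct naturals distinct in [F]. *)
Lemma poly_eq_nodes s p r : uniq s -> (size p <= size s)%N ->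
  (size r <= size s)%N -> {in s, forall i, p.[i%:R] = r.[i%:R]} -> p = r.
Proof.
move=> us hp hr e; apply/eqP; rewrite -subr_eq0.
rewrite (@roots_geq_poly_eq0 _ (p - r) [seq i%:R | i <- s]) //.
- by apply/allP => _ /mapP [i si ->]; rewrite rootE !hornerE e // subrr.
- by rewrite map_inj_uniq // => i j /eqP; rewrite eqr_nat => /eqP.
by rewrite size_map (leq_trans (size_polyD _ _)) // size_polyN geq_max hp.
Qed.

(** By uniqueness [p] is its own Lagrange interpolant, a combination of monic polynomials of size
    [size s]. *)
Lemma coef_divdiff s p : uniq s -> (size p <= size s)%N ->
  p`_(size s).-1 = divdiff s (fun i => p.[i%:R]).
Proof.
move=> us hp; rewrite -coef_lagrange_poly //; congr (polyseq _)`__.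
apply: (poly_eq_nodes _ _ _ us) => // [|i si]; first exact: size_lagrange_poly.
by rewrite horner_lagrange_poly.
Qed.

Lemma divdiff_cst s (a : F) : uniq s -> (1 < size s)%N ->
  divdiff s (fun=> a) = 0.
Proof.
move=> us s1; transitivity ((a%:P : {poly F})`_(size s).-1).
  rewrite coef_divdiff //; last by rewrite (leq_trans (size_polyC_leq1 _)) // ltnW.
  by apply: eq_bigr => i _; rewrite hornerC.
by rewrite coefC; case: (size s) s1 => [|[]].
Qed.

(** The new node adds the factor [(i%:R - z%:R)^-1], which cancels up to sign. This is the sign that
    each integration contributes. *)
Lemma divdiff_weight_rcons s z i : i \in s -> z \notin s ->
  divdiff_weight (rcons s z) i * (z%:R - i%:R) = - divdiff_weight s i :> F.
Proof.
move=> si zs; have zi : z != i by apply: contraNneq zs => ->.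
rewrite /divdiff_weight big_rcons /= zi.
have d : i%:R - z%:R != 0 :> F by rewrite subr_eq0 eqr_nat eq_sym.
by field.
Qed.

End DividedDifference.

(** Links the formal derivative to the analytic one, so that the integrals below reduce to
    polynomial algebra. *)
Lemma is_derive_horner (p : {poly R}) (x : R) :
  is_derive (fun t : R => p.[t] : R) x (p^`().[x] : R).
Proof.
elim/poly_ind: p => [|p a IH].
  rewrite derivC horner0; apply: (is_derive_ext (fun=> 0 : R)) => [t|].
    by rewrite horner0.
  exact: is_derive_const.
rewrite derivD derivC addr0 derivM derivX mulr1 hornerD hornerM hornerX.
apply: (is_derive_ext (fun t : R => Rplus (Rmult p.[t] t) a)) => [t|].
  by rewrite hornerMXaddC.
auto_derive; first by exists p^`().[x].
have -> : Derive (fun t : R => p.[t]) x = p^`().[x] by exact: is_derive_unique.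
by rewrite !RplusE !RmultE mul1r mulr1 addrC.
Qed.

Lemma RInt_deriv_horner (p : {poly R}) (a b : R) :
  RInt (fun t : R => p^`().[t] : R) a b = p.[b] - p.[a].
Proof.
apply: is_RInt_unique; apply: (is_RInt_derive (fun t : R => p.[t])) => x _.
  exact: is_derive_horner.
apply: ex_derive_continuous; exists (p^`()^`().[x]); exact: is_derive_horner.
Qed.

Definition nodes (c : seq nat) : seq nat :=
  [seq partial_sum c i | i <- iota 0 (size c).+1].

Lemma size_nodes c : size (nodes c) = (size c).+1.
Proof. by rewrite size_map size_iota. Qed.

Lemma nodes_rcons c m : nodes (rcons c m) = rcons (nodes c) (sumn c + m)%N.
Proof.
rewrite /nodes size_rcons -[in iota _ _]addn1 iotaD map_cat cats1 add0n.
congr rcons; last by rewrite /partial_sum -(size_rcons c m) take_size sumn_rcons.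
apply/eq_in_map => i; rewrite mem_iota add0n ltnS => /andP [_ ic].
by rewrite /partial_sum -cats1 takel_cat.
Qed.

Lemma nodes_le c b : b \in nodes c -> (b <= sumn c)%N.
Proof.
case/mapP => i _ ->; rewrite /partial_sum -{2}(cat_take_drop i c) sumn_cat.
exact: leq_addr.
Qed.

Lemma is_composition_rcons c m :
  is_composition (rcons c m) = (0 < m)%N && is_composition c.
Proof. exact: all_rcons. Qed.

Lemma sumn_notin_nodes c m : (0 < m)%N -> (sumn c + m)%N \notin nodes c.
Proof.
by move=> m0; apply/negP => /nodes_le; rewrite -{2}[sumn c]addn0 leq_add2l leqNgt m0.
Qed.

Lemma nodes_uniq c : is_composition c -> uniq (nodes c).
Proof.
elim/last_ind: c => [|c m IH] //; rewrite is_composition_rcons => /andP [m0 /IH u].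
by rewrite nodes_rcons rcons_uniq u sumn_notin_nodes.
Qed.

(** Both [u] and [w] must vary: opening the outermost integral, that of the last part of [c],
    replaces them by [t] and [t ^+ m.-1 * w]. *)
Lemma iterated_RInt_divdiff (q : R) c (u w : R) : is_composition c ->
  iterated_RInt q (rev c) u w =
  w * (-1) ^+ size c * divdiff (nodes c) (fun b => q ^+ b * u ^+ (sumn c - b)).
Proof.
elim/last_ind: c u w => [|c m IH] u w.
  move=> _; rewrite /nodes /divdiff /divdiff_weight /= !big_cons !big_nil /=.
  by rewrite /partial_sum /= !expr0 !mulr1 addr0 mulr1.
move=> cm; move: (cm); rewrite is_composition_rcons => /andP [m0 cc].
rewrite rev_rcons /= size_rcons.
have us := nodes_uniq _ cm; set z := (sumn c + m)%N.
have sumz : sumn (rcons c m) = z by rewrite sumn_rcons.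
have zN := sumn_notin_nodes c _ m0.
(* The claimed right-hand side as a polynomial in [u], a candidate antiderivative of the
   integrand. *)
pose P : {poly R} := (w * (-1) ^+ (size c).+1) *:
  \sum_(b <- nodes (rcons c m))
    (q ^+ b * divdiff_weight (nodes (rcons c m)) b) *: 'X^(z - b).
have PE t : P.[t] = w * (-1) ^+ (size c).+1 *
    divdiff (nodes (rcons c m)) (fun b => q ^+ b * t ^+ (z - b)).
  rewrite hornerZ horner_sum; congr (_ * _); apply: eq_bigr => b _.
  by rewrite hornerZ hornerXn mulrAC.
have Pq : P.[q] = 0.
  rewrite PE -[RHS](mulr0 (w * (-1) ^+ (size c).+1)); congr (_ * _).
  rewrite -(divdiff_cst _ _ (q ^+ z) us); last by rewrite size_nodes size_rcons.
  rewrite /divdiff !big_seq; apply: eq_bigr => b /nodes_le.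
  by rewrite sumz => bz; rewrite -exprD subnKC.
transitivity (RInt (fun t : R => P^`().[t] : R) q u); last first.
  by rewrite RInt_deriv_horner Pq subr0 PE sumz.
apply: RInt_ext => t _; rewrite IH // /P derivZ hornerZ raddf_sum horner_sum.
(* The term of the new node [z] has exponent [z - z = 0], so differentiation kills it and only the
   old nodes remain. *)
rewrite nodes_rcons big_rcons /= -/z subnn expr0 derivZ derivC scaler0 horner0.
rewrite ?addr0 ?add0r /divdiff !mulr_sumr !big_seq; apply: eq_bigr => b bc.
have bs := nodes_le _ _ bc.
(* Truncated subtraction is exact here since [b <= sumn c] and [0 < m]. The factor [z - b] produced
   by differentiation then turns the new weight into the old one. *)
have -> : (z - b = ((sumn c - b) + m.-1).+1)%N.
  by rewrite -addnS prednK // /z -addnBAC.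
rewrite derivZ derivXn hornerZ hornerMn hornerXn /= -mulr_natr.
have -> : (((sumn c - b) + m.-1).+1)%:R = z%:R - b%:R :> R.
  rewrite -addnS prednK // addnBAC // natrB //.
  by rewrite (leq_trans bs) ?leq_addr.
rewrite -[divdiff_weight (nodes c) b]opprK -(divdiff_weight_rcons _ _ _ _ bc zN).
by rewrite exprD exprS /z; ring.
Qed.

Lemma interpolates_nodes c (q : R) (p : {poly R}) :
  interpolates c q p <-> {in nodes c, forall b, p.[b%:R] = q ^+ b}.
Proof.
split=> [ip _ /mapP [i + ->]|ip i ic].
  by rewrite mem_iota add0n ltnS => /andP [_]; exact: ip.
by apply: ip; apply: map_f; rewrite mem_iota add0n ltnS.
Qed.

Theorem theorem6p6 (c : seq nat) (hc : is_composition c) (q : R)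
    (h : {poly R}) (hh : min_interpolant c q h) :
  h`_(size c) = (-1) ^+ size c * composition_polynomial c q.
Proof.
have us := nodes_uniq _ hc; case: hh => /interpolates_nodes ih hmin.
(* Minimality of [h] enters here: the Lagrange interpolant competes and bounds the degree by
   [size c]. *)
have sh : (size h <= size (nodes c))%N.
  pose f (b : nat) : R := q ^+ b.
  apply: leq_trans (hmin (lagrange_poly _ (nodes c) f) _) (size_lagrange_poly _ _ _ us).
  by apply/interpolates_nodes => b bc; rewrite horner_lagrange_poly.
have := coef_divdiff _ _ _ us sh; rewrite size_nodes /= => ->.
(* At [u = w = 1] the powers of [u] disappear, and the two signs multiply to 1. *)
rewrite /composition_polynomial iterated_RInt_divdiff // mul1r mulrA -exprMn.
rewrite mulrNN mulr1 expr1n mul1r /divdiff !big_seq.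
by apply: eq_bigr => b bc; rewrite ih // expr1n mulr1.
Qed.
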